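(* Let $G$ be a Jposy-graph. Then every vertex $v$ of $G$ belongs to an $M$-Tposy of $G$, for some maximum matching $M$ of $G$.
   Context: All graphs are finite, undirected and simple. A matching is a set of pairwise nonadjacent edges; a maximum matching is a matching of maximum cardinality; a matching is perfect if every vertex is an endpoint of one of its edges. A walk in $G$ is a sequence of vertices $v_1v_2\cdots v_k$ with $v_iv_{i+1}\in E(G)$ for all $i$; its length is its number of edges counted with repetition. A path is a walk whose vertices are all different. A walk or path is $M$-alternating if for each pair of consecutive edges exactly one belongs to $M$; it is $mm$-alternating if moreover its first and last edges belong to $M$. Let $M$ be a maximum matching of $G$. An $M$-blossom is an odd cycle of length $2k+1$ in $G$ containing exactly $k$ edges of $M$; its base is the unique vertex of the cycle that is not matched by $M$ to another vertex of the cycle. An $M$-Tposy consists of two distinct (not necessarily disjoint) $M$-blossoms joined by an odd-length $mm$-alternating path (with respect to $M$) whose endpoints are the bases of the two blossoms and which is internally disjoint from the blossoms (no internal vertex of the path lies on either blossom). An $M$-Jposy consists of two (not necessarily distinct) $M$-blossoms joined by an odd-length $mm$-alternating walk (with respect to $M$) whose endpoints are the bases of the two blossoms. The vertices and edges of a configuration are those of its blossoms and of its path or walk. A graph $G$ is a Jposy-graph if there exists a perfect matching $M$ of $G$ such that $G$ contains an $M$-Jposy that uses all the vertices and all the edges of $G$. The maximum matching $M$ in the claim may depend on the vertex $v$. *)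

(* Defs.v *)
From mathcomp Require Import all_boot.
Set Implicit Arguments.
Unset Strict Implicit.
Unset Printing Implicit Defensive.

Record sgraph := SGraph {
  svertex :> finType;
  adj : rel svertex;
  adj_sym : symmetric adj;
  adj_irrefl : irreflexive adj
}.

(* An edge is the 2-element set of its endpoints. *)
Definition edges (G : sgraph) : {set {set G}} :=
  [set [set u; v] | u in G, v in G & adj u v].

Definition matching (G : sgraph) (M : {set {set G}}) : bool :=
  (M \subset edges G) && trivIset M.

Definition maximum_matching (G : sgraph) (M : {set {set G}}) : bool :=
  matching M && [forall N : {set {set G}}, matching N ==> (#|N| <= #|M|)].

Definition perfect_matching (G : sgraph) (M : {set {set G}}) : bool :=
  matching M && (cover M == [set: G]).

(* The walk v_1 v_2 ... v_k is given by its first vertex x = v_1 and the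
   sequence p = [:: v_2; ...; v_k]; its length is size p. *)
Definition walk (G : sgraph) (x : G) (p : seq G) : bool := path (@adj G) x p.

Definition simple_path (G : sgraph) (x : G) (p : seq G) : bool :=
  walk x p && uniq (x :: p).

(* The successive edges v_i v_(i+1), with repetition. *)
Definition walk_edges (G : sgraph) (x : G) (p : seq G) : seq {set G} :=
  pairmap (fun u v => [set u; v]) x p.

Definition internal_vertices (G : sgraph) (x : G) (p : seq G) : seq G :=
  behead (belast x p).

Definition alternating (G : sgraph) (M : {set {set G}}) (x : G) (p : seq G)
  : bool :=
  sorted (fun f g : {set G} => (f \in M) (+) (g \in M)) (walk_edges x p).

Definition mm_alternating (G : sgraph) (M : {set {set G}}) (x : G) (p : seq G)
  : bool :=
  alternating M x p &&
  (if walk_edges x p is f :: s then (f \in M) && (last f s \in M) else false).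

(* A cycle is the cyclic sequence of its (distinct) vertices. *)
Definition graph_cycle (G : sgraph) (c : seq G) : bool :=
  [&& 2 < size c, uniq c & cycle (@adj G) c].

Definition cycle_edges (G : sgraph) (c : seq G) : {set {set G}} :=
  [set [set u; next c u] | u in c].

Definition blossom (G : sgraph) (M : {set {set G}}) (c : seq G) : Prop :=
  graph_cycle c /\
  exists k : nat, size c = 2 * k + 1 /\ #|cycle_edges c :&: M| = k.

Definition blossom_base (G : sgraph) (M : {set {set G}}) (c : seq G) (b : G)
  : bool :=
  (b \in c) && [forall u in c, (u != b) ==> ([set b; u] \notin M)].

(* The data of a Tposy or Jposy: two cyclic sequences and a walk. *)
Record posy (G : sgraph) := Posy {
  cyc1 : seq G;
  cyc2 : seq G;
  wstart : G;
  wtail : seq G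
}.

Definition posy_vertices (G : sgraph) (P : posy G) : {set G} :=
  [set v | [|| v \in cyc1 P, v \in cyc2 P | v \in wstart P :: wtail P]].

Definition posy_edges (G : sgraph) (P : posy G) : {set {set G}} :=
  cycle_edges (cyc1 P) :|: cycle_edges (cyc2 P)
    :|: [set f in walk_edges (wstart P) (wtail P)].

Definition Jposy (G : sgraph) (M : {set {set G}}) (P : posy G) : Prop :=
  [/\ blossom M (cyc1 P) /\ blossom M (cyc2 P),
      walk (wstart P) (wtail P) /\ odd (size (wtail P)),
      mm_alternating M (wstart P) (wtail P),
      blossom_base M (cyc1 P) (wstart P)
    & blossom_base M (cyc2 P) (last (wstart P) (wtail P))].

(* Blossoms are compared as subgraphs, by their edge sets: one cycle is
   represented by several sequences, differing by rotation and reversal. *)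
Definition Tposy (G : sgraph) (M : {set {set G}}) (P : posy G) : Prop :=
  [/\ blossom M (cyc1 P) /\ blossom M (cyc2 P),
      cycle_edges (cyc1 P) <> cycle_edges (cyc2 P),
      simple_path (wstart P) (wtail P) /\ odd (size (wtail P)),
      mm_alternating M (wstart P) (wtail P)
    & [/\ blossom_base M (cyc1 P) (wstart P),
          blossom_base M (cyc2 P) (last (wstart P) (wtail P))
        & forall u, u \in internal_vertices (wstart P) (wtail P) ->
            u \notin cyc1 P /\ u \notin cyc2 P]].

Definition Jposy_graph (G : sgraph) : Prop :=
  exists M : {set {set G}}, perfect_matching M /\
    exists P : posy G,
      [/\ Jposy M P, posy_vertices P = [set: G] & posy_edges P = edges G].

(* Main.v *)
Require Import Defs.
From mathcomp Require Import all_boot.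
Set Implicit Arguments.
Unset Strict Implicit.
Unset Printing Implicit Defensive.

(** Encode a perfect matching by its involution [m] and consider the digraph
    with an arc from x to y when x is adjacent to [m y]: its walks are the
    alternating walks starting with an edge outside the matching, and [m]
    reverses its arcs.  Going around the blossoms and along the walk of a Jposy
    in both directions shows that this digraph is strongly connected.

    Given v, take a maximal set B containing v, disjoint from its set of mates
    W, and strongly connected in itself.  Strong connectivity yields an
    alternating excursion out of B that starts at some u in B and ends at B or
    on itself, and likewise one out of W starting at some w.  By maximality of
    B the two excursions are either disjoint, or they meet in the stem of the
    first one.  Between B and W the graph is bipartite and elementary, so after
    switching the matching inside B and W there is an alternating w-u path
    through v whose end edges are in the matching (the bipartite case of
    Little's theorem).  Closing this path at both ends by the excursions gives a
    Tposy; if the excursions meet, the path and the two excursions up to the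
    meeting point form one blossom, and the rest of the first one provides the
    stem and the other blossom. *)

(** * Walks, cycles and prefixes for an arbitrary relation *)

Lemma cycle_rejoin (T : eqType) (e : rel T) t c d : symmetric e ->
  path e t c -> path e t d -> e (last t c) (last t d) ->
  cycle e (t :: c ++ rev d).
Proof.
move=> es pc pd cd; rewrite /cycle rcons_cat -rev_cons lastI rev_rcons.
rewrite cat_path pc /= cd rev_path.
by rewrite (eq_path (e' := e)) // => x y; apply: es.
Qed.

Lemma first_entry (T : finType) (e : rel T) (A : pred T) x y :
  connect e x y -> x \notin A -> y \in A ->
  exists p z, [/\ path e x p, uniq (x :: p),
    forall w, w \in x :: p -> w \notin A, z \in A & e (last x p) z].
Proof.
case/connectP=> q qp ->{y} xA.
elim: q x xA qp => [|h q IH] x xA /=; first by rewrite (negPf xA).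
case/andP=> xh qp lA; have [hA|hA] := boolP (h \in A).
  by exists [::], h; split=> // w; rewrite inE => /eqP->.
have [p [z [pp _ pA zA lz]]] := IH h hA qp lA.
have xp : path e x (h :: p) by rewrite /= xh.
have lst : last x (h :: p) = last h p by [].
case: (shortenP xp) lst => p' p'p u' sub lst.
exists p', z; split=> //; last by rewrite lst.
by move=> w; rewrite inE => /predU1P[->//|/sub]; apply: pA.
Qed.

Lemma last_exit (T : finType) (e : rel T) (A : pred T) x y :
  connect e x y -> x \in A ->
  exists z p, [/\ path e z p, uniq (z :: p), z \in A, last z p = y
    & forall w, w \in p -> w \notin A].
Proof.
case/connectP=> q /shortenP[p pp up _] ->{y q}; have [n] := ubnP (size p).
elim: n x p pp up => // n IH x p pp up; rewrite ltnS => sp xA.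
have [/hasP[h hp hA]|/hasPn nA] := boolP (has [in A] p); last by exists x, p.
case/splitPr: hp pp up sp => p1 p2; rewrite -cat_cons cat_uniq => pp /and3P[_ _ up].
move: pp; rewrite cat_path last_cat size_cat /= => /and3P[_ _ pp] sp.
apply: IH => //; apply: leq_trans sp.
by rewrite addnS ltnS leq_addl.
Qed.

Lemma sorted_cat_cons (T : eqType) (e : rel T) s x s' :
  sorted e (s ++ x :: s') = sorted e (rcons s x) && path e x s'.
Proof. by case: s => //= y s; rewrite cat_path rcons_path /= andbA. Qed.

Lemma last_good_prefix (T : Type) (Q : pred (seq T)) s : Q [::] -> ~~ Q s ->
  exists p h s', [/\ s = p ++ h :: s', Q p & ~~ Q (rcons p h)].
Proof.
move=> Q0; elim/last_ind: s => [|s h IH]; first by rewrite Q0.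
have [Qs nQ|/IH[p [k [s' [-> Qp nQ]]]] _] := boolP (Q s).
  by exists s, h, [::]; rewrite cats1.
by exists p, k, (rcons s' h); rewrite rcons_cat.
Qed.

Section Jposies.
Variable G : sgraph.
Implicit Types (m : G -> G) (x y : G) (p s c d : seq G) (B W : {set G})
  (M : {set {set G}}).

(** * Pairings and alternating walks *)

Definition pairing m := involutive m /\ forall x, adj x (m x).
Definition pair_edges m : {set {set G}} := [set [set x; m x] | x in G].
Definition arc m : rel G := fun x y => adj x (m y).
(** The entries of [s] come from different matching edges; this is what keeps the walk [zig m s]
    free of repetitions. *)
Definition indep m s := uniq s && all (fun x => m x \notin s) s.
(* If x1, x2, ... is a path for [arc m] leaving x, then [x :: zig m [:: x1; x2; ..]]
   is the corresponding alternating walk of G. *)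
Definition zig m s : seq G := flatten [seq [:: m x; x] | x <- s].

Lemma pairing_neq m x : pairing m -> (m x == x) = false.
Proof. by case=> _ /(_ x); apply: contraTF => /eqP->; rewrite adj_irrefl. Qed.

Lemma arc_skew m x y : pairing m -> arc m (m y) (m x) = arc m x y.
Proof. by case=> mK _; rewrite /arc mK adj_sym. Qed.

Lemma path_skew m x p : pairing m ->
  path (arc m) x p -> path (arc m) (m (last x p)) (map m (rev (belast x p))).
Proof.
move=> hm; rewrite path_map rev_path.
by apply: sub_path => a b /=; rewrite arc_skew.
Qed.

Lemma last_skew m x p : last (m (last x p)) (map m (rev (belast x p))) = m x.
Proof.
by rewrite last_map; case: p => //= y p; rewrite rev_cons last_rcons.
Qed.

Lemma indepP m s :
  reflect (uniq s /\ forall x, x \in s -> m x \notin s) (indep m s).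
Proof. by apply: (iffP andP) => -[us /allP]. Qed.

Lemma indep_sub m s s' :
  uniq s' -> {subset s' <= s} -> indep m s -> indep m s'.
Proof.
move=> us' sub /indepP[_ h]; apply/indepP; split=> // x /sub/h.
by apply: contra => /sub.
Qed.

Lemma mem_zig m s x : involutive m -> (x \in zig m s) = (x \in s) || (m x \in s).
Proof.
move=> mK; elim: s => //= y s IH; rewrite !inE IH (inv_eq mK).
by do 2!case: (x == _); rewrite ?orbT.
Qed.

Lemma zig_cat m s s' : zig m (s ++ s') = zig m s ++ zig m s'.
Proof. by rewrite /zig map_cat flatten_cat. Qed.

Lemma size_zig m s : size (zig m s) = (size s).*2.
Proof. by elim: s => //= x s ->. Qed.

Lemma last_zig m x s : last x (zig m s) = last x s.
Proof. by elim: s x => //= y s IH x. Qed.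

Lemma path_zig m x s : pairing m -> path (@adj G) x (zig m s) = path (arc m) x s.
Proof.
case=> mK hm; elim: s x => //= y s IH x; rewrite IH.
by rewrite [adj (m y) y]adj_sym hm.
Qed.

Lemma uniq_zig m s : pairing m -> indep m s -> uniq (zig m s).
Proof.
move=> hm; case: (hm) => mK _; elim: s => //= x s IH /indepP /= [/andP[xs us] h].
rewrite inE !mem_zig // mK (pairing_neq _ hm) (negPf xs) orbF /=.
have := h x (mem_head _ _); rewrite inE negb_or => /andP[_ ->] /=.
by apply: IH; apply: indep_sub (introT (indepP m (x :: s)) _) => //=;
  [move=> z zs; rewrite inE zs orbT | rewrite xs us].
Qed.

Lemma in_pair_edges m x y : involutive m ->
  ([set x; y] \in pair_edges m) = (y == m x).
Proof.
move=> mK; apply/imsetP/eqP => [[z _ /setP e]|->]; last by exists x.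
have := e x; have := e y; have := e z; have := e (m z); rewrite !inE !eqxx !orbT /=.
move=> /pred2P ez /pred2P ez' /esym/pred2P ey /esym/pred2P ex.
by case: ey ex ez ez' => -> [] -> [] // h [] h'; rewrite ?mK // -?h -?h' ?mK.
Qed.

(** * Blossoms and Tposies built from alternating walks *)

Lemma next_cat_cons s s' x y :
  uniq (s ++ x :: y :: s') -> next (s ++ x :: y :: s') x = y.
Proof.
move=> us; rewrite next_nth mem_cat mem_head orbT.
have xs : x \notin s.
  by move: us; rewrite cat_uniq => /and3P[_ /hasPn /(_ x) h _]; apply: h; rewrite mem_head.
case: s us xs => [|z s] us xs /=; first by rewrite eqxx.
rewrite inE negb_or in xs; case/andP: xs => zx xs.
by rewrite eq_sym (negPf zx) index_cat (negPf xs) /= eqxx addn0 nth_cat ltnNge leqnSn /= subSnn.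
Qed.

Lemma zigP m c x : x \in c -> exists s s', zig m c = s ++ m x :: x :: s'.
Proof.
case/splitPr=> c1 c2; exists (zig m c1), (zig m c2).
by apply: zig_cat.
Qed.

(* The cycle closed by an edge between the ends of two walks issued from t; t is
   its base. *)
Definition loop m t c d := t :: zig m c ++ rev (zig m d).

Lemma mem_loop m t c d : loop m t c d =i t :: zig m (c ++ d).
Proof. by move=> x; rewrite !inE zig_cat !mem_cat mem_rev. Qed.

Lemma uniq_loop m t c d : pairing m -> indep m (t :: c ++ d) -> uniq (loop m t c d).
Proof.
move=> hm h; have : uniq (t :: zig m (c ++ d)) by case/andP: (uniq_zig hm h).
by rewrite /loop zig_cat !cons_uniq !mem_cat mem_rev !cat_uniq rev_uniq has_rev.
Qed.

Lemma loop_mate m t c d : pairing m -> indep m (t :: c ++ d) ->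
  m t \notin loop m t c d.
Proof.
move=> hm h; rewrite mem_loop.
by have /andP[] : uniq (m t :: t :: zig m (c ++ d)) := uniq_zig hm h.
Qed.

Lemma blossom_loop m t c d : pairing m -> indep m (t :: c ++ d) ->
  path (arc m) t c -> path (arc m) t d -> adj (last t c) (last t d) ->
  blossom (pair_edges m) (loop m t c d).
Proof.
move=> hm hi pc pd lcd; have [mK ha] := hm.
have ul := uniq_loop hm hi.
have sz : size (loop m t c d) = 2 * (size c + size d) + 1.
  by rewrite /= size_cat size_rev !size_zig -doubleD -mul2n addn1.
split.
  apply/and3P; split=> //.
    have : 0 < size c + size d.
      rewrite lt0n; apply: contraTneq lcd => /eqP; rewrite addn_eq0.
      by case/andP=> /nilP-> /nilP->; rewrite adj_irrefl.
    by rewrite sz addn1 ltnS; case: (_ + _) => // n _; rewrite mulnS.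
  by apply: cycle_rejoin; rewrite ?path_zig ?last_zig //; apply: adj_sym.
exists (size c + size d); split=> //.
(* The base contributes no matching edge, as [m t] is off the cycle. Each entry x of [c ++ d]
   contributes one: on the side of [c] the vertex [m x] comes just before x, on the reversed side of
   [d] just after it. *)
have -> : cycle_edges (loop m t c d) :&: pair_edges m =
          [set [set x; m x] | x in c ++ d].
  apply/setP=> f; rewrite inE; apply/andP/imsetP.
    case=> /imsetP[u uc ->]; rewrite in_pair_edges // => /eqP nu; rewrite nu.
    have := uc; rewrite mem_loop inE => /predU1P[ut|].
      by have := loop_mate hm hi; rewrite -{1}ut -nu mem_next uc.
    rewrite mem_zig // => /orP[uz|uz]; first by exists u.
    by exists (m u) => //; rewrite mK setUC.
  case=> x xcd ->; split; last by rewrite in_pair_edges.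
  move: xcd; rewrite mem_cat => /orP[/(zigP m)|/(zigP m)] [s [s' e]].
    apply/imsetP; exists (m x).
      by rewrite /loop e; rewrite !inE !mem_cat !inE eqxx !orbT.
    move: ul; rewrite /loop e -catA -!cat_cons => ul.
    by rewrite next_cat_cons // setUC.
  apply/imsetP; exists x.
    by rewrite /loop e; rewrite !inE !mem_cat mem_rev !mem_cat !inE eqxx !orbT.
  have e' : loop m t c d = (t :: zig m c ++ rev s') ++ x :: m x :: rev s.
    by rewrite /loop e rev_cat !rev_cons -!cats1 -!catA /= -!catA.
  by rewrite e' next_cat_cons // -e'.
rewrite card_in_imset.
  rewrite -[RHS]size_cat; apply/card_uniqP.
  by case/indepP: hi => /= /andP[].
move=> x y /= xc yc /setP /(_ x); rewrite !inE eqxx /= => /esym/pred2P[//|xy].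
case/indepP: hi => _ /(_ y); rewrite !inE yc orbT => /(_ isT).
by rewrite -xy xc orbT.
Qed.

Lemma loop_base m t c d : pairing m -> indep m (t :: c ++ d) ->
  blossom_base (pair_edges m) (loop m t c d) t.
Proof.
move=> hm hi; rewrite /blossom_base mem_head /=.
apply/forall_inP=> u uc; apply/implyP=> _; rewrite in_pair_edges; last by case: hm.
by apply: contraL uc => /eqP->; apply: loop_mate.
Qed.

(** The edge [f] stands for the one traversed just before [a]. Steps from [a] to [m b] leave the
    matching because a differs from b, and steps from [m b] to b return to it. *)
Lemma walk_edges_zig m a s (f : {set G}) : pairing m -> uniq (a :: s) ->
  f \in pair_edges m ->
  path (fun f g : {set G} => (f \in pair_edges m) (+) (g \in pair_edges m)) f
    (walk_edges a (zig m s)) && (last f (walk_edges a (zig m s)) \in pair_edges m).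
Proof.
move=> hm; have mK : involutive m by case: hm.
elim: s a f => [|b s IH] a f /=; first by move=> _ ->.
rewrite inE negb_or -andbA => /and3P[ab _ us] hf.
have ub : [set m b; b] \in pair_edges m by rewrite in_pair_edges ?mK.
have [p l] := andP (IH b _ us ub).
rewrite hf ub p l !in_pair_edges // (inj_eq (inv_inj mK)) eq_sym (negPf ab) //.
Qed.

(* The path of the Tposy is [m a :: zig m (a :: s)]. *)
Lemma tposy_of_loops m a s c d c' d' :
  pairing m -> indep m (a :: s ++ c ++ d) -> indep m (a :: s ++ c' ++ d') ->
  path (arc m) a s ->
  path (arc m) (last a s) c -> path (arc m) (last a s) d ->
  adj (last (last a s) c) (last (last a s) d) ->
  path (arc m) (m a) c' -> path (arc m) (m a) d' ->
  adj (last (m a) c') (last (m a) d') ->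
  exists P : posy G, Tposy (pair_edges m) P /\
    forall x, x \in (a :: s) ++ c ++ d ++ c' ++ d' ->
      x \in posy_vertices P /\ m x \in posy_vertices P.
Proof.
move=> hm i1 i2 ps pc pd lcd pc' pd' lcd'.
have mK : involutive m by case: hm.
set t := last a s in pc pd lcd *.
have ts : t \in a :: s by apply: mem_last.
have [u1 f1] := indepP _ _ i1; have [u2 f2] := indepP _ _ i2.
have su1 : uniq ((a :: s) ++ (c ++ d)) := u1.
have su2 : uniq ((a :: s) ++ (c' ++ d')) := u2.
have i1' : indep m (t :: c ++ d).
  apply: indep_sub i1.
    move: su1; rewrite cat_uniq => /and3P[_ /hasPn h ucd] /=; rewrite ucd andbT.
    by apply/negP=> /h; rewrite ts.
  by move=> x; rewrite inE => /predU1P[->|h]; rewrite -cat_cons mem_cat ?ts ?h ?orbT.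
(* The second blossom hangs at the other end of the matching edge of [a], so [a] is traded for its
   mate. *)
have i2' : indep m (m a :: c' ++ d').
  have [ucd ha] : uniq (c' ++ d') /\ a \notin c' ++ d'.
    by move: u2; rewrite /= mem_cat negb_or cat_uniq => /andP[/andP[_ ->] /and3P[_ _ ->]].
  have := f2 a (mem_head _ _); rewrite -cat_cons mem_cat negb_or => /andP[_ hma].
  apply/indepP; split; first by rewrite /= hma.
  move=> x; rewrite !inE negb_or => /predU1P[->|xcd]; rewrite ?mK.
    by rewrite eq_sym (pairing_neq _ hm).
  rewrite (inj_eq (inv_inj mK)) (contraNneq _ ha) => [|<-//] /=.
  have := f2 x; rewrite -cat_cons !(mem_cat _ (a :: s)) xcd orbT => /(_ isT).
  by rewrite negb_or => /andP[].
pose P := Posy (loop m (m a) c' d') (loop m t c d) (m a) (a :: zig m s).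
have zu1 : uniq (zig m (a :: s) ++ zig m (c ++ d)) by rewrite -zig_cat uniq_zig.
have zu2 : uniq (zig m (a :: s) ++ zig m (c' ++ d')) by rewrite -zig_cat uniq_zig.
have lst : last (m a) (a :: zig m s) = t by rewrite /= last_zig.
exists P; split; last first.
  have inP z : (z \in posy_vertices P) = [|| z \in loop m (m a) c' d',
      z \in loop m t c d | z \in zig m (a :: s)] by rewrite inE.
  move=> x hx; rewrite !inP !mem_loop !in_cons !mem_zig // mK.
  move: hx; rewrite !mem_cat !in_cons (inj_eq (inv_inj mK)).
  case: (x == a) => [_|/=]; first by split; rewrite ?orbT.
  case: (x \in s) => [_|/=]; first by split; rewrite ?orbT.
  case: (x \in c) => [_|/=]; first by split; rewrite ?orbT.
  case: (x \in d) => [_|/=]; first by split; rewrite ?orbT.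
  case: (x \in c') => [_|/= ->]; by split; rewrite ?orbT.
split.
- by split; apply: blossom_loop.
(* The base [t] lies on its own blossom; if the edge sets agreed it would lie on the other blossom
   too, which avoids it. *)
- move=> E; have : [set t; next (loop m t c d) t] \in cycle_edges (loop m (m a) c' d').
    by rewrite E; apply/imsetP; exists t => //=; apply: mem_head.
  case/imsetP=> u uc' /setP /(_ t); rewrite !inE eqxx => /esym h.
  have : t \in loop m (m a) c' d'.
    by case/pred2P: h => ->; rewrite ?mem_next.
  rewrite mem_loop inE => /orP[/eqP tma|].
    by have := f1 t; rewrite -cat_cons !(mem_cat _ (a :: s)) ts => /(_ isT); rewrite tma mK mem_head.
  move: zu2; rewrite cat_uniq => /and3P[_ /hasPn h' _] /h'.
  by rewrite mem_zig // ts.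
- split; last by rewrite /= size_zig odd_double.
  apply/andP; split; last by move: zu1; rewrite cat_uniq => /andP[].
  by rewrite /walk /= path_zig // ps adj_sym; case: hm => _ ->.
- rewrite /mm_alternating /alternating /=.
  have M1 : [set m a; a] \in pair_edges m by rewrite in_pair_edges ?mK.
  have us : uniq (a :: s) by move: su1; rewrite cat_uniq => /andP[].
  by rewrite M1 /= walk_edges_zig.
split.
- exact: loop_base.
- by rewrite lst loop_base.
move=> u; rewrite /internal_vertices /= => ui.
have uz : u \in m a :: a :: zig m s by rewrite in_cons (mem_belast ui) orbT.
have [ua ut] : u != m a /\ u != t.
  move: zu1; rewrite cat_uniq => /andP[+ _].
  have -> : zig m (a :: s) = m a :: rcons (belast a (zig m s)) t.
    by rewrite -[t](last_zig m) -lastI.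
  rewrite cons_uniq rcons_uniq mem_rcons in_cons negb_or.
  case/and3P=> /andP[_ h1] h2 _.
  by split; [apply: contraNneq h1 | apply: contraNneq h2] => <-.
rewrite !mem_loop !inE (negPf ua) (negPf ut) /=; split.
  by move: zu2; rewrite cat_uniq => /and3P[_ /hasPn h _]; apply/negP=> /h; rewrite uz.
by move: zu1; rewrite cat_uniq => /and3P[_ /hasPn h _]; apply/negP=> /h; rewrite uz.
Qed.

(** * Rerouting in elementary bipartite subgraphs *)

(** When [m] swaps [B] and [W], these arcs are the edges between [B] and [W]: the edge from x in [B]
    to [m y] is read as an arc from x to y. *)
Definition darc m B : rel G := fun x y => [&& x \in B, y \in B & arc m x y].
Definition strong m B := {in B &, forall x y, connect (darc m B) x y}.
Definition swaps m B W := {in B, forall x, m x \in W} /\ {in W, forall x, m x \in B}.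

Lemma path_darc m B x p : path (darc m B) x p ->
  path (arc m) x p /\ {subset p <= B}.
Proof.
elim: p x => //= y p IH x /andP[/and3P[_ yB xy] /IH[-> sub]]; split; rewrite ?xy //.
by move=> z; rewrite inE => /predU1P[->|/sub].
Qed.

Lemma eq_path_arc m m' x p : {in p, m =1 m'} -> path (arc m) x p = path (arc m') x p.
Proof.
elim: p x => //= y p IH x h; rewrite (IH y) => [|z zp].
  by rewrite /arc h ?mem_head.
by apply: h; rewrite inE zp orbT.
Qed.

Lemma eq_indep m m' p : {in p, m =1 m'} -> indep m p = indep m' p.
Proof. by move=> h; congr (_ && _); apply: eq_in_all => x xp; rewrite h. Qed.

(* Strong connectivity amounts to the surplus condition |N(S)| > |S| for the
   proper nonempty subsets S of B, which does not mention the matching. *)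
Lemma strong_indep m m' B W : pairing m -> pairing m' ->
  swaps m B W -> swaps m' B W -> strong m B -> strong m' B.
Proof.
move=> [mK ma] [mK' ma'] [BW WB] [BW' WB'] st x y xB yB.
pose S := [set z in B | connect (darc m' B) x z].
have xS : x \in S by rewrite inE xB connect0.
have SB z : z \in S -> z \in B by rewrite inE => /andP[].
(* Under [m'], every neighbour in [W] of the reachable set [S] is the mate of a vertex of [S]. *)
have clos w z : z \in S -> w \in W -> adj z w -> w \in m' @: S.
  move=> zS wW zw; apply/imsetP; exists (m' w); last by rewrite mK'.
  rewrite inE WB' //=; move: (zS); rewrite inE => /andP[zB cz].
  apply: connect_trans cz (connect1 _).
  by rewrite /darc zB WB' //= /arc mK'.
(* The [m]-mates of [S] are such neighbours, and there are as many of them as [m']-mates. Hence the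
   two sets of mates agree and no arc of [m] inside [B] leaves [S]. *)
have sub : m @: S \subset m' @: S.
  by apply/subsetP=> _ /imsetP[z zS ->]; apply: (clos _ z) => //; apply/BW/SB.
have eqS : m @: S = m' @: S.
  apply/eqP; rewrite eqEcard sub /=.
  by rewrite !card_imset //; apply: inv_inj.
have step z z' : z \in S -> darc m B z z' -> z' \in S.
  move=> zS /and3P[_ z'B zz']; rewrite -(mem_imset _ _ (inv_inj mK)) eqS.
  by apply: clos zz' => //; apply: BW.
suff: y \in S by rewrite inE => /andP[].
have /connectP[p pp ->] := st x y xB yB.
have close q z : z \in S -> path (darc m B) z q -> last z q \in S.
  by elim: q z => //= z' q IH z zS /andP[/(step _ _ zS) z'S /(IH _ z'S)].
exact: close.
Qed.

(* When a follows b on the route, the ear from a to b closes an alternating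
   cycle, and switching the matching along it reroutes through the ear. *)
Lemma route_ear m B W w u s a e b :
  pairing m -> swaps m B W -> [disjoint B & W] -> w \in W -> u \in B ->
  sorted (arc m) s -> uniq s -> {subset s <= B} ->
  m (head u s) = w -> last w s = u ->
  a \in s -> path (arc m) a e -> uniq e -> {subset e <= B} ->
  (forall x, x \in e -> x \notin s) -> b \in s -> arc m (last a e) b ->
  exists m' s', [/\ pairing m', swaps m' B W,
      forall x, x \notin B -> x \notin W -> m' x = m x &
    [/\ sorted (arc m') s', uniq s', {subset s' <= B} &
    [/\ m' (head u s') = w, last w s' = u &
      forall x, x \in e -> (x \in s') && (m' (m x) \in s')]]].
Proof.
move=> hm [BW WB] dBW wW uB ss us sB hs ls as_ pe ue eB es bs eb.
have [mK ma] := hm.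
case/splitPr: as_ => s1 s2 in ss us sB hs ls es bs *.
(* If b comes after a, the ear replaces the piece of the route between them and the matching is
   kept. *)
have [bs2|bs2] := boolP (b \in s2).
  case/splitPr: bs2 => s3 s4 in ss us sB hs ls es bs *.
  have sub : subseq (rcons s1 a ++ b :: s4) (s1 ++ a :: s3 ++ b :: s4).
    by rewrite -(cat_rcons a); apply: cat_subseq => //; apply: suffix_subseq.
  exists m, (s1 ++ a :: e ++ b :: s4); split=> //; split.
  - move: ss; rewrite !sorted_cat_cons => /andP[-> /=].
    by rewrite !cat_path pe /= eb => /and3P[].
  - rewrite -cat_rcons (perm_uniq (permEl (perm_catCA _ _ _))) cat_uniq ue.
    rewrite (subseq_uniq sub us) andbT /=; apply/hasPn=> x /(mem_subseq sub) xs.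
    by apply: contraL xs => /es.
  - move=> x; rewrite -cat_rcons (perm_mem (permEl (perm_catCA _ _ _))) mem_cat.
    by case/orP=> [/eB|/(mem_subseq sub)/sB].
  split.
  - by case: (s1) hs.
  - by move: ls; rewrite !last_cat /= !last_cat.
  by move=> x xe; rewrite mK !(mem_cat, in_cons) xe ?orbT.
have {bs2 bs} : b \in rcons s1 a.
  by move: bs; rewrite -cat_rcons mem_cat (negPf bs2) orbF.
move: ss us sB hs ls es; rewrite -cat_rcons.
set s1a := rcons s1 a => ss us sB hs ls es bs.
have : last b s1a = a by rewrite last_rcons.
case/splitPr: bs ss us sB hs ls es => s3 s4.
rewrite last_cat -catA /= => ss us sB hs ls es la.
set Z := b :: s4 ++ e.
have ZB x : x \in Z -> x \in B.
  rewrite /Z -cat_cons mem_cat => /orP[xs|/eB//].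
  by apply: sB; rewrite mem_cat -cat_cons mem_cat xs orbT.
have ZW x : x \in W -> x \notin Z.
  by move=> xW; apply: contraL xW => /ZB xB; rewrite (disjointFr dBW).
have uZ : uniq Z.
  move: us; rewrite cat_uniq -cat_cons cat_uniq => /and3P[_ _ /and3P[u4 _ _]].
  rewrite /Z -cat_cons cat_uniq u4 ue andbT /=; apply/hasPn=> x /es.
  by apply: contra => xs; rewrite mem_cat -cat_cons mem_cat xs orbT.
have pb4 : path (arc m) b s4.
  by move: ss; rewrite sorted_cat_cons cat_path => /and3P[].
have cZ : cycle (arc m) Z.
  by rewrite /Z /= rcons_cat cat_path pb4 la rcons_path pe.
(* Switching along the alternating cycle encoded by [Z]: a vertex of [Z] takes the mate of its
   successor, so a mate of a vertex of [Z] is given the predecessor of that vertex. *)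
pose m' x := if x \in Z then m (next Z x) else
             if m x \in Z then prev Z (m x) else m x.
have m'out x : x \notin Z -> x \notin W -> m' x = m x.
  move=> xZ xW; rewrite /m' (negPf xZ) ifN //; apply: contra xW => /ZB/BW.
  by rewrite mK.
have m'Z x : x \in Z -> m' x = m (next Z x) by rewrite /m' => ->.
have m'mZ x : x \in Z -> m' (m x) = prev Z x.
  by move=> xZ; rewrite /m' mK xZ (negPf (ZW _ (BW _ (ZB _ xZ)))).
have hm' : pairing m'.
  split=> x.
    have [xZ|xZ] := boolP (x \in Z).
      by rewrite (m'Z x) // m'mZ ?mem_next // prev_next.
    have [mxZ|mxZ] := boolP (m x \in Z).
      have -> : m' x = prev Z (m x) by rewrite -m'mZ // mK.
      by rewrite m'Z ?mem_prev // next_prev // mK.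
    by rewrite {2}/m' (negPf xZ) (negPf mxZ) /m' (negPf mxZ) mK (negPf xZ).
  have [xZ|xZ] := boolP (x \in Z); first by rewrite m'Z //; exact: (next_cycle cZ xZ).
  have [mxZ|mxZ] := boolP (m x \in Z); last first.
    by rewrite /m' (negPf xZ) (negPf mxZ).
  have -> : m' x = prev Z (m x) by rewrite -m'mZ // mK.
  by have := prev_cycle cZ mxZ; rewrite /arc mK adj_sym.
have sw' : swaps m' B W.
  split=> x xB; rewrite /m'.
    case: ifP => [xZ|_]; first by apply/BW/ZB; rewrite mem_next.
    by rewrite ifN ?BW // ZW // BW.
  rewrite (negPf (ZW _ xB)); case: ifP => [xZ|_]; last exact: WB.
  by apply: ZB; rewrite mem_prev.
have nx : path (frel (next Z)) a (rcons e b).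
  by have := cycle_next uZ; rewrite /= rcons_cat cat_path la => /andP[].
move: nx; rewrite rcons_path => /andP[ne /eqP nl].
set z := last a e in eb nl *.
have zZ : z \in Z.
  have : z \in a :: e by apply: mem_last.
  rewrite inE /Z -cat_cons mem_cat => /predU1P[->|->]; last by rewrite orbT.
  by rewrite -la mem_last.
have aeZ x : x \in a :: e -> x \in Z.
  rewrite inE /Z -cat_cons mem_cat => /predU1P[->|->]; last by rewrite orbT.
  by rewrite -la mem_last.
have subZ x : x \in s3 ++ s2 -> (x \notin Z) * (m' x = m x).
  move=> xs.
  have xQ : x \in s3 ++ b :: s4 ++ s2.
    by move: xs; rewrite !(mem_cat, inE) => /orP[]->; rewrite ?orbT.
  have xZ : x \notin Z.
    rewrite /Z -cat_cons mem_cat negb_or; apply/andP; split.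
      move: us; rewrite -cat_cons (uniq_catCA s3) cat_uniq => /and3P[_ /hasPn h _].
      exact: h.
    by apply: contraL xQ; apply: es.
  by split=> //; rewrite m'out // (disjointFr dBW) // sB.
have sub : subseq (s3 ++ a :: s2) (s3 ++ b :: s4 ++ s2).
  apply: cat_subseq => //; rewrite -cat_cons -cat1s; apply: cat_subseq => //.
  by rewrite sub1seq -la mem_last.
have QE : perm_eq (s3 ++ z :: rev (belast a e) ++ s2) (e ++ s3 ++ a :: s2).
  rewrite -cat_cons -rev_rcons -lastI; apply/permP=> P.
  by rewrite !count_cat count_rev /= -addnA (addnCA (P a : nat)) addnCA.
have lr : last z (rev (belast a e)) = a.
  by rewrite /z; case: (e) => //= c0 e0; rewrite rev_cons last_rcons.
(* Switching reverses the arcs along [Z]. The end [z] of the ear now has the mate that [b] had, so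
   the route enters the ear there, follows it backwards to [a] and goes on as before. *)
exists m', (s3 ++ z :: rev (belast a e) ++ s2); split=> //.
  by move=> x xB xW; apply: m'out; rewrite // (contra (@ZB x)).
split.
- rewrite sorted_cat_cons cat_path lr; apply/and3P; split.
  + move: ss; rewrite sorted_cat_cons => /andP[+ _].
    case: (lastP s3) subZ => // s5 x subZ.
    rewrite -!cats1 -!catA !sorted_cat_cons /= {2 4}/arc m'Z // nl.
    case/andP=> sx ->; rewrite andbT.
    case: s5 sx subZ => //= y s5 sx subZ.
    rewrite -(eq_path_arc (m := m)) // => x' x's; rewrite subZ //.
    by rewrite in_cons mem_cat x's !orbT.
  + rewrite rev_path; apply: (@sub_in_path _ [in Z]) ne; last exact/allP.
    by move=> x y xZ _ /= /eqP<-; rewrite /arc m'Z //; apply: ma.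
  + move: ss; rewrite sorted_cat_cons cat_path la => /and3P[_ _].
    by rewrite (eq_path_arc (m' := m')) // => x xs; rewrite subZ // mem_cat xs orbT.
- rewrite (perm_uniq QE) cat_uniq ue (subseq_uniq sub us) andbT /=.
  by apply/hasPn=> x /(mem_subseq sub) xs; apply: contraL xs => /es.
- by move=> x; rewrite (perm_mem QE) mem_cat => /orP[/eB|/(mem_subseq sub)/sB].
split.
- case: (s3) hs subZ => [|y s3'] /= hs subZ; first by rewrite m'Z // nl.
  by rewrite subZ ?mem_head.
- by move: ls; rewrite !last_cat /= !last_cat lr la.
(* The vertex [m x] is on the new alternating path because its new mate is the predecessor of x on
   the cycle, which is [a] or an earlier vertex of the ear. *)
move=> x xe; rewrite (perm_mem QE) mem_cat xe /= m'mZ ?aeZ ?inE ?xe ?orbT //.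
have [x' x'e <-] : exists2 x', x' \in a :: e & next Z x' = x.
  case/splitPr: xe ne => e1 e2; rewrite cat_path => /and3P[_ /eqP nx _].
  by exists (last a e1); rewrite // -cat_cons mem_cat mem_last.
rewrite prev_next // (perm_mem QE) !(mem_cat, in_cons).
by move: x'e; rewrite in_cons => /orP[]->; rewrite ?orbT.
Qed.

(* The bipartite case of Little's theorem that two edges of a matching covered
   graph lie on a common alternating cycle: the set of vertices that can be
   covered is closed under adjacency between B and W. *)
Lemma route_through m0 B W w u v :
  pairing m0 -> swaps m0 B W -> [disjoint B & W] -> strong m0 B ->
  w \in W -> u \in B -> v \in B :|: W ->
  exists m s, [/\ pairing m, swaps m B W,
      forall x, x \notin B -> x \notin W -> m x = m0 x &
    [/\ sorted (arc m) s, uniq s, {subset s <= B} &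
    [/\ m (head u s) = w, last w s = u & (v \in s) || (m v \in s)]]].
Proof.
move=> hm0 sw0 dBW st0 wW uB.
pose covered x := exists m s, [/\ pairing m, swaps m B W,
      forall x, x \notin B -> x \notin W -> m x = m0 x &
    [/\ sorted (arc m) s, uniq s, {subset s <= B} &
    [/\ m (head u s) = w, last w s = u & (x \in s) || (m x \in s)]]].
rewrite -/(covered v).
have ear m s a e b : pairing m -> swaps m B W ->
    (forall x, x \notin B -> x \notin W -> m x = m0 x) ->
    [/\ sorted (arc m) s, uniq s & {subset s <= B}] ->
    m (head u s) = w -> last w s = u ->
    a \in s -> path (darc m B) a e -> uniq e ->
    (forall x, x \in e -> x \notin s) -> b \in s -> arc m (last a e) b ->
    forall x, x \in e -> covered x /\ covered (m x).
  move=> hm sw out [ss us sB] hs ls as_ /path_darc[pe eB] ue es bs eb x xe.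
  have [m' [s' [hm' sw' out' [ss' us' sB' [hs' ls' cov]]]]] :=
    route_ear hm sw dBW wW uB ss us sB hs ls as_ pe ue eB es bs eb.
  have [xs mxs] := andP (cov x xe).
  split; exists m', s'; split=> //; try by move=> y yB yW; rewrite out' ?out.
    by split=> //; split=> //; rewrite xs.
  by split=> //; split=> //; rewrite mxs orbT.
have step a x : covered a -> adj a x ->
    (a \in B) && (x \in W) || (a \in W) && (x \in B) -> covered x.
  move=> [m [s [hm sw out [ss us sB [hs ls as_]]]]] ax.
  have [mK ma] := hm; have [BW WB] := sw.
  have st : strong m B by apply: strong_indep st0; eassumption.
  have nW y : y \in s -> y \notin W by move/sB => yB; rewrite (disjointFr dBW).
  case/orP=> /andP[aX xX].
    (* For [a] in [B], the ear leaves [a] by the arc to [m x] and continues inside [B] until it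
       first meets the route again. *)
    have {}as_ : a \in s by case/orP: as_ => // /nW/negP[]; apply: BW.
    have [mxs|mxs] := boolP (m x \in s).
      by exists m, s; split=> //; split=> //; split=> //; rewrite mxs orbT.
    have [p [z [pp up pA zA lz]]] :=
      first_entry (A := [in s]) (st _ _ (WB _ xX) aX) mxs as_.
    rewrite -[x]mK; apply: (proj2 (ear m s a (m x :: p) z _ _ _ _ _ _ _ _ _ _ _ _ (m x) _)) => //.
    - by rewrite /= pp andbT /darc aX WB //= /arc mK.
    - by case/and3P: lz.
    - exact: mem_head.
  (* For [a] in [W], the ear is the final part, after the last vertex on the route, of a walk inside
     [B] to [x]; the edge from [x] to [a] then gives an arc back to [m a]. *)
  have {}as_ : m a \in s.
    by case/orP: as_ => // /nW; rewrite aX.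
  have [xs|xs] := boolP (x \in s).
    by exists m, s; split=> //; split=> //; split=> //; rewrite xs.
  have [z [p [pp /= /andP[_ up] zA lp pA]]] :=
    last_exit (A := [in s]) (st _ _ (WB _ aX) xX) as_.
  have xp : x \in p.
    by have := mem_last z p; rewrite lp inE => /predU1P[xz|//]; rewrite xz zA in xs.
  apply: (proj1 (ear m s z p (m a) _ _ _ _ _ _ _ _ _ _ _ _ x xp)) => //.
  by rewrite lp /arc mK adj_sym.
have [mK ma] := hm0; have [BW WB] := sw0.
(* To start the propagation, any path inside [B] from [m0 w] to [u] is a route through [u]. *)
have cu : covered u.
  have /connectP[p /shortenP[q pq uq _] lq] := st0 _ _ (WB _ wW) uB.
  have [aq qB] := path_darc pq.
  exists m0, (m0 w :: q); split=> //; split=> //.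
    by move=> x; rewrite inE => /predU1P[->|/qB//]; apply: WB.
  by split=> //=; rewrite lq mem_last.
have close p y : covered y -> path (darc m0 B) y p -> covered (last y p).
  elim: p y => //= z p IH y cy /andP[/and3P[yB zB yz]]; apply: IH.
  have cz : covered (m0 z) by apply: step cy yz _; rewrite yB BW.
  by apply: step cz _ _; rewrite ?(adj_sym (m0 z)) ?ma // BW // zB orbT.
have cB x : x \in B -> covered x.
  by move=> xB; have /connectP[p pp ->] := st0 _ _ uB xB; apply: close.
rewrite inE => /orP[/cB//|vW].
by apply: (step (m0 v)); rewrite ?(adj_sym (m0 v)) ?ma ?WB ?vW //; apply/cB/WB.
Qed.

(** * Closing a path into a Tposy *)

Definition apart m s s' := all (fun x => (x \notin s') && (m x \notin s')) s.
(** Walking an alternating walk backwards meets both ends of each matching edge in the opposite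
    order, so the list is reversed and its entries replaced by their mates. *)
Definition mrev m s := map m (rev s).

Lemma apartP m s s' :
  reflect (forall x, x \in s -> x \notin s' /\ m x \notin s') (apart m s s').
Proof. by apply: (iffP allP) => [h x /h/andP|h x /h[-> ->]]. Qed.

Lemma apart_sub m s1 s2 s1' s2' : {subset s1 <= s1'} -> {subset s2 <= s2'} ->
  apart m s1' s2' -> apart m s1 s2.
Proof.
move=> h1 h2 /apartP h; apply/apartP=> x /h1/h[a b].
by split; [apply: contra a | apply: contra b] => /h2.
Qed.

Lemma apart_sym m s s' : involutive m -> apart m s s' = apart m s' s.
Proof.
move=> mK; suff h s1 s2 : apart m s1 s2 -> apart m s2 s1 by apply/idP/idP => /h.
move/apartP=> h; apply/apartP=> x xs; split; apply: contraL xs => /h[] //.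
by rewrite mK.
Qed.

Lemma apart_catl m s1 s2 s : apart m (s1 ++ s2) s = apart m s1 s && apart m s2 s.
Proof. exact: all_cat. Qed.

Lemma apart_catr m s s1 s2 : involutive m ->
  apart m s (s1 ++ s2) = apart m s s1 && apart m s s2.
Proof. by move=> mK; rewrite !(apart_sym s) // apart_catl. Qed.

Lemma apart_mrevl m s s' : involutive m -> apart m (mrev m s) s' = apart m s s'.
Proof.
move=> mK; rewrite /apart all_map all_rev.
by apply: eq_all => x /=; rewrite mK andbC.
Qed.

Lemma apart_mrevr m s s' : involutive m -> apart m s (mrev m s') = apart m s s'.
Proof. by move=> mK; rewrite !(apart_sym s) // apart_mrevl. Qed.

Lemma indep_cat m s1 s2 : involutive m ->
  indep m (s1 ++ s2) = [&& indep m s1, indep m s2 & apart m s1 s2].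
Proof.
move=> mK; apply/indepP/and3P.
  rewrite cat_uniq => -[/and3P[u1 /hasPn h u2] f].
  have f' x : x \in s1 ++ s2 -> (m x \notin s1) && (m x \notin s2).
    by move/f; rewrite mem_cat negb_or.
  split.
  - apply/indepP; split=> // x xs.
    by have /f'/andP[] : x \in s1 ++ s2 by rewrite mem_cat xs.
  - apply/indepP; split=> // x xs.
    by have /f'/andP[] : x \in s1 ++ s2 by rewrite mem_cat xs orbT.
  - apply/apartP=> x xs; split; first by apply: contraL xs => /h.
    by have /f'/andP[] : x \in s1 ++ s2 by rewrite mem_cat xs.
case=> /indepP[u1 f1] /indepP[u2 f2] ap; have := ap; rewrite (apart_sym _ _ mK).
move: ap => /apartP a12 /apartP a21; split.
  by rewrite cat_uniq u1 u2 andbT; apply/hasPn=> x /a21[].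
move=> x; rewrite !mem_cat negb_or => /orP[xs|xs].
  by rewrite f1 //; case: (a12 x xs).
by rewrite f2 // andbT; case: (a21 x xs).
Qed.

Lemma indep_mrev m s : involutive m -> indep m (mrev m s) = indep m s.
Proof.
move=> mK; rewrite /indep (map_inj_uniq (inv_inj mK)) rev_uniq all_map all_rev.
congr (_ && _); apply: eq_all => x /=; rewrite mK /mrev.
by rewrite -[x in x \in map _ _]mK (mem_map (inv_inj mK)) mem_rev.
Qed.

Lemma path_mrev m x p y : pairing m -> path (arc m) x (rcons p y) ->
  path (arc m) (m y) (mrev m (x :: p)).
Proof. by move=> hm /(path_skew hm); rewrite last_rcons belast_rcons. Qed.

Lemma last_mrev m x y p : last y (mrev m (x :: p)) = m x.
Proof. by rewrite /mrev rev_cons map_rcons last_rcons. Qed.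

Lemma strong_swap m B W : pairing m -> swaps m B W -> strong m B -> strong m W.
Proof.
move=> hm [BW WB] st x y xW yW; have [mK _] := hm.
have /connectP[p pp lp] := st _ _ (WB _ yW) (WB _ xW).
apply/connectP; exists (mrev m (belast (m y) p)); last first.
  by rewrite -[x]mK lp -[y in LHS]mK last_skew.
rewrite -[x]mK lp path_map rev_path; apply: sub_path pp => a b.
by case/and3P=> aB bB ab; rewrite /darc /= !BW //= arc_skew.
Qed.

(** Every vertex of the ear is reached from [x] along the ear and leads on to [y], from where [B]
    leads back to [x]. *)
Lemma strong_extend m B x p y : strong m B -> x \in B -> y \in B ->
  path (arc m) x p -> arc m (last x p) y -> strong m (B :|: [set z in p]).
Proof.
move=> st xB yB pp ly; set B' := _ :|: _.
have BB' z : z \in B -> z \in B' by rewrite inE => ->.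
have lift a b : a \in B -> b \in B -> connect (darc m B') a b.
  move=> aB bB; apply: connect_sub (st a b aB bB) => c d /and3P[cB dB cd].
  by apply: connect1; rewrite /darc !BB'.
have pp' : path (darc m B') x (rcons p y).
  have sub : {subset x :: rcons p y <= B'}.
    move=> z; rewrite inE mem_rcons !inE.
    by case/or3P=> [/eqP->|/eqP->|->]; rewrite ?xB ?yB ?orbT.
  have : path (arc m) x (rcons p y) by rewrite rcons_path pp.
  elim: (rcons p y) (x) sub => //= a s IH b sub /andP[ba ps].
  rewrite /darc !sub ?inE ?eqxx ?orbT //= ba IH // => z zs.
  by apply: sub; rewrite inE zs orbT.
have both z : z \in B' -> connect (darc m B') x z /\ connect (darc m B') z x.
  rewrite inE => /orP[zB|]; first by split; apply: lift.
  rewrite inE => zp; case/splitPr: zp pp' => p1 p2.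
  rewrite rcons_cat cat_path rcons_cons => /= /and3P[h1 h2 h3]; split.
    by apply/connectP; exists (rcons p1 z); rewrite ?last_rcons ?rcons_path ?h1.
  apply: connect_trans (lift _ _ yB xB).
  by apply/connectP; exists (rcons p2 y); rewrite ?last_rcons.
move=> a b /both[_ ax] /both[xb _]; exact: connect_trans ax xb.
Qed.

(** If the closing vertex [y] is on the excursion [q], the loop is already there. If it is in [C], a
    walk inside [C] from the end of [l] to [y] is cut at its last vertex on [a :: l]; the rest of it
    is the second side [d] of the loop based at that vertex. Only the mates of [a :: l] are required
    to avoid [C], since at the second end of a Tposy this walk may contain part of the first
    excursion. *)
Lemma close_end m (C : {set G}) a l q y :
  pairing m -> strong m C -> {in C, forall x, m x \notin C} ->
  path (arc m) a (l ++ q) -> last a l \in C ->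
  {in a :: l, forall x, m x \notin C} -> indep m (a :: l ++ q) ->
  apart m q (enum C) -> adj (last a (l ++ q)) y -> (y \in C) || (y \in q) ->
  exists s c d, [/\ l ++ q = s ++ c, path (arc m) (last a s) d,
    adj (last (last a s) c) (last (last a s) d), indep m (a :: s ++ c ++ d)
    & {subset d <= C}].
Proof.
move=> hm st pf pp lC lm ind aq ly /orP[yC|yq]; last first.
  case/splitPr: yq pp ind ly aq => q1 q2 pp ind ly aq.
  exists (l ++ rcons q1 y), q2, [::].
  by rewrite cats0 -!catA cat_rcons !last_cat last_rcons /= in ly *; split.
have mK : involutive m by case: hm.
have [z [d [pd ud zl ld dl]]] :=
  last_exit (A := [in a :: l]) (st _ _ lC yC) (mem_last a l).
have [pd' dC] := path_darc pd.
have [s [c [els lsz]]] : exists s c, l = s ++ c /\ last a s = z.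
  move: zl; rewrite inE => /predU1P[->|]; first by exists [::], l.
  by case/splitPr=> l1 l2; exists (rcons l1 z), l2; rewrite cat_rcons last_rcons.
exists s, (c ++ q), d; split=> //.
- by rewrite els catA.
- by rewrite lsz.
- by move: ly; rewrite els lsz ld -catA last_cat lsz.
rewrite -[_ :: _]/((a :: s) ++ (c ++ q) ++ d) catA indep_cat //.
have -> : (a :: s) ++ c ++ q = a :: l ++ q by rewrite els -catA.
rewrite ind andTb; apply/andP; split.
  apply/indepP; split=> [|x /dC xC]; first by case/andP: ud.
  by apply: contra (pf x xC) => /dC.
move/apartP: aq => aq; rewrite apart_sym //; apply/apartP=> x xd; have xC := dC _ xd.
have xq z' : z' = x \/ z' = m x -> z' \notin q.
  move=> zx; apply/negP=> /aq[].
  by rewrite !mem_enum; case: zx => ->; rewrite ?mK xC.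
rewrite -cat_cons !(mem_cat _ (a :: l)) !negb_or !xq; try by [left|right].
split; rewrite andbT; first by rewrite -negb_or; exact: dl.
by rewrite -negb_or; apply/negP=> h; have := lm (m x) h; rewrite mK xC.
Qed.

(* Follow a walk from x to [m x], from its last vertex in C until it first comes
   back to the mate of one of its vertices or of a vertex of C. *)
Lemma lollipop m (C : {set G}) x : pairing m -> (forall y z, connect (arc m) y z) ->
  {in C, forall y, m y \notin C} -> x \in C ->
  exists x0 p y, [/\ x0 \in C, path (arc m) x0 p, indep m p, apart m p (enum C)
    & adj (last x0 p) y /\ (y \in C) || (y \in p)].
Proof.
move=> hm conn Cm xC; have mK : involutive m by case: hm.
have [z [p [pp up zC lp pC]]] := last_exit (A := [in C]) (conn x (m x)) xC.
pose Q s := apart m s (enum C) && indep m s.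
(* The walk ends at [m x], the mate of a vertex of [C], so it cannot be good as a whole. *)
have nQ : ~~ Q p.
  apply/negP=> /andP[/apartP h _]; have := mem_last z p; rewrite lp inE.
  case/predU1P=> [mz|/h[_]]; first by have := Cm _ xC; rewrite mz zC.
  by rewrite mK mem_enum xC.
have [s [h [s' [e /andP[aps ins] nQh]]]] := last_good_prefix isT nQ.
have uh : uniq (rcons s h).
  by move: up; rewrite e -cat_rcons cons_uniq cat_uniq => /and3P[_ ].
have hC : h \notin C by apply: (pC h); rewrite e mem_cat mem_head orbT.
(* The last vertex of [s] has an arc to [h], hence is adjacent to [m h]; since [h] spoils the
   prefix, [m h] lies in [C] or on [s]. *)
exists z, s, (m h); split=> //.
  by move: pp; rewrite e cat_path => /andP[].
split; first by move: pp; rewrite e cat_path => /and3P[].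
apply: contraNT nQh; rewrite negb_or => /andP[mhC mhs].
rewrite /Q -cats1 apart_catl aps indep_cat // ins /= !mem_enum hC mhC /=.
rewrite apart_sym // /indep /apart /= inE (pairing_neq _ hm) mhs !andbT.
by move: uh; rewrite rcons_uniq => /andP[].
Qed.

(** Both excursions enter the matching edge of [h] at [m h]. Followed backwards from [m h] they come
    together again at the edge leaving [m b], which gives a blossom based at [m h] through all of
    [b :: l]. The stem [h :: s] then leads to the blossom closed by [c]. *)
Lemma tposy_crossing m b l p h s c q :
  pairing m ->
  indep m ((b :: l) ++ p ++ (h :: s) ++ c ++ q) ->
  path (arc m) b (l ++ p ++ (h :: s) ++ c) -> path (arc m) (m b) (rcons q h) ->
  adj (last (last h s) c) (last h s) ->
  exists P : posy G, Tposy (pair_edges m) P /\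
    forall x, x \in b :: l -> x \in posy_vertices P /\ m x \in posy_vertices P.
Proof.
move=> hm ind pb pq lc; have mK : involutive m by case: hm.
have psc : path (arc m) h (s ++ c).
  move: pb; rewrite (cat_path _ _ l) (cat_path _ _ p) => /and3P[_ _].
  by case/andP.
have pr : path (arc m) (m h) (mrev m (b :: l ++ p)).
  apply: path_mrev => //; rewrite -cats1.
  by move: pb; rewrite !cat_path last_cat /= => /and3P[-> -> /andP[/andP[->]]].
have pq' : path (arc m) (m h) (mrev m q) /\ adj (last (m h) (mrev m q)) (m b).
  have := path_mrev hm pq; rewrite /mrev rev_cons map_rcons rcons_path.
  by rewrite /arc mK => /andP[].
move: psc; rewrite cat_path => /andP[ps pc].
move: ind; rewrite !indep_cat // !apart_catr //.
case/and3P=> il /and3P[ip /and3P[ihs /and3P[ic iq acq] /andP[ahsc ahsq]]].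
case/and3P=> aphs apc apq /and4P[alp alhs alc alq].
have [P [TP cov]] : exists P : posy G, Tposy (pair_edges m) P /\
    forall x, x \in (h :: s) ++ c ++ [::] ++ mrev m ((b :: l) ++ p) ++ mrev m q ->
      x \in posy_vertices P /\ m x \in posy_vertices P.
  apply: tposy_of_loops => //.
  - by rewrite cats0 -cat_cons indep_cat // ihs ic.
  - rewrite -cat_cons !indep_cat // !apart_catr // !apart_mrevr // !apart_mrevl //.
    rewrite !indep_mrev // indep_cat // !apart_catl ihs il ip alp iq.
    by rewrite alq apq ahsq (apart_sym (h :: s)) // apart_catl alhs aphs.
  - by case: pq'.
  - by rewrite last_mrev adj_sym; case: pq'.
exists P; split=> // x xl.
have [] := cov (m x); last by rewrite mK.
by rewrite !mem_cat (mem_map (inv_inj mK)) mem_rev mem_cat xl !orbT.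
Qed.

(** [close_end] is applied twice: first to the excursion leaving [B], then, after reversing the stem
    obtained, to the one leaving [W]. A vertex of [b :: l] may end up on the stem or on either
    blossom. *)
Lemma tposy_closing m B W b l p y q y' :
  pairing m -> swaps m B W -> [disjoint B & W] -> strong m B ->
  uniq (b :: l) -> {subset b :: l <= B} ->
  path (arc m) b (l ++ p) -> adj (last b (l ++ p)) y -> (y \in B) || (y \in p) ->
  path (arc m) (m b) q -> adj (last (m b) q) y' -> (y' \in W) || (y' \in q) ->
  indep m p -> indep m q -> apart m p q ->
  apart m p (enum B) -> apart m q (enum B) ->
  exists P : posy G, Tposy (pair_edges m) P /\
    forall x, x \in b :: l -> x \in posy_vertices P /\ m x \in posy_vertices P.
Proof.
move=> hm sw dBW st ul lB pb ly yBp pq lq yWq ip iq apq apB aqB.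
have mK : involutive m by case: hm.
have [BW WB] := sw.
have BnW x : x \in B -> x \notin W by move=> xB; rewrite (disjointFr dBW).
have WnB x : x \in W -> x \notin B by move=> xB; rewrite (disjointFl dBW).
have stW := strong_swap hm sw st.
have subB : {subset b :: l <= enum B} by move=> x /lB; rewrite mem_enum.
have il : indep m (b :: l).
  by apply/indepP; split=> // x /lB xB; apply: contra (WnB _ (BW _ xB)) => /lB.
have ilp : indep m ((b :: l) ++ p).
  by rewrite indep_cat // il ip !andTb apart_sym //; apply: apart_sub apB.
have [|||s [c [d [elp pd lcd icd dB]]]] :=
  close_end hm st _ pb _ _ ilp apB ly yBp.
- by move=> x xB; apply/WnB/BW.
- by apply/lB/mem_last.
- by move=> x /lB xB; apply/WnB/BW.
set t := last b s in pd lcd *.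
have [psb pc] : path (arc m) b s /\ path (arc m) t c.
  by apply/andP; rewrite -cat_path -elp.
pose l' := mrev m (belast b s).
have el' : m t :: l' = mrev m (b :: s).
  by rewrite /mrev (lastI b) rev_rcons.
have pl' : path (arc m) (m t) (l' ++ q).
  by rewrite cat_path path_skew //= /l' last_skew.
have sW x : x \in b :: s -> m x \notin B.
  have : {subset b :: s <= (b :: l) ++ p}.
    by move=> z; rewrite [_ ++ _]/= elp -cat_cons mem_cat => ->.
  move=> sub /sub; rewrite mem_cat => /orP[/lB/BW/WnB//|xp].
  by move/apartP: apB => /(_ x xp) []; rewrite !mem_enum.
have asq : apart m (b :: s ++ c ++ d) q.
  rewrite -!cat_cons !apart_catl.
  have h : apart m ((b :: l) ++ p) q.
    by rewrite apart_catl apq andbT apart_sym //; apply: apart_sub aqB.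
  move: h; rewrite [_ ++ _]/= elp -cat_cons apart_catl => /andP[-> ->]; rewrite !andTb.
  by rewrite apart_sym //; apply: apart_sub aqB => // x /dB; rewrite mem_enum.
have ibs : indep m (b :: s).
  by move: icd; rewrite -cat_cons indep_cat // => /and3P[].
have il'q : indep m (m t :: l' ++ q).
  rewrite -cat_cons el' indep_cat // indep_mrev // ibs iq apart_mrevl //.
  by move: asq; rewrite -cat_cons apart_catl => /andP[].
have aqW : apart m q (enum W).
  apply/apartP=> x xq; move/apartP: aqB => /(_ x xq) []; rewrite !mem_enum => h1 h2.
  by split; [apply: contra h2 => /WB | apply: contra h1 => /WB; rewrite mK].
have [||||s' [c' [d' [elq pd' lcd' icd' dW]]]] :=
  close_end hm stW _ pl' _ _ il'q aqW _ yWq.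
- by move=> x xW; apply/BnW/WB.
- by rewrite last_skew; apply/BW/lB/mem_head.
- move=> x; rewrite el' => /mapP[z]; rewrite mem_rev => zs ->; rewrite mK.
  by apply: contra (sW _ zs) => /WB.
- by rewrite last_cat last_skew.
have [ps' pc'] : path (arc m) (m t) s' /\ path (arc m) (last (m t) s') c'.
  by apply/andP; rewrite -cat_path -elq.
have [P [TP cov]] : exists P : posy G, Tposy (pair_edges m) P /\
    forall x, x \in (m t :: s') ++ c' ++ d' ++ c ++ d ->
      x \in posy_vertices P /\ m x \in posy_vertices P.
  apply: tposy_of_loops => //; rewrite ?mK //.
  have sub : {subset m t :: s' <= mrev m (b :: s) ++ q}.
    by move=> x; rewrite -el' cat_cons elq -cat_cons mem_cat => ->.
  rewrite -cat_cons indep_cat //; apply/and3P; split.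
  - by move: icd'; rewrite -cat_cons indep_cat // => /and3P[].
  - by move: icd; rewrite -cat_cons indep_cat // => /and3P[].
  apply: (apart_sub (s2' := c ++ d) sub) => //; rewrite apart_catl apart_mrevl //.
  move: icd; rewrite -cat_cons indep_cat // => /and3P[_ _ ->]; rewrite andTb.
  by move: asq; rewrite -cat_cons apart_catl (apart_sym q) // => /andP[].
exists P; split=> // x xl.
have : x \in b :: s ++ c by rewrite -elp -cat_cons mem_cat xl.
rewrite -cat_cons mem_cat => /orP[xs|xc]; last first.
  by apply: cov; rewrite !mem_cat xc !orbT.
have [] := cov (m x); last by rewrite mK.
have : m x \in (m t :: l') ++ q by rewrite el' mem_cat mem_map ?mem_rev ?xs //; apply: inv_inj.
rewrite cat_cons elq -cat_cons !mem_cat => /orP[]->; rewrite ?orbT //.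
Qed.

Lemma tposy_of_connect m v : pairing m -> (forall x y, connect (arc m) x y) ->
  exists m', pairing m' /\
    exists P : posy G, Tposy (pair_edges m') P /\ v \in posy_vertices P.
Proof.
move=> hm conn; have [mK ma] := hm.
pose Q (B : {set G}) := [&& v \in B, [forall x in B, m x \notin B]
  & [forall x in B, forall y in B, connect (darc m B) x y]].
have Q1 : Q [set v].
  rewrite /Q set11 /=; apply/andP; split; apply/forall_inP=> x /set1P->.
    by rewrite inE (pairing_neq _ hm).
  by apply/forall_inP=> y /set1P->.
have [B maxB _] := maxset_exists Q1.
have /and3P[vB /forall_inP Bm Bst] := maxsetp maxB.
have {Bst} st : strong m B.
  by move=> x y xB yB; move/forall_inP: Bst => /(_ x xB)/forall_inP; apply.
pose W := m @: B.
have inW x : (x \in W) = (m x \in B).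
  by rewrite -[x in LHS]mK mem_imset //; apply: inv_inj.
have sw : swaps m B W by split=> x; rewrite inW ?mK.
have dBW : [disjoint B & W].
  by rewrite disjoint_subset; apply/subsetP=> x xB; rewrite inE inW Bm.
have apW s : apart m s (enum W) = apart m s (enum B).
  by apply: eq_all => x; rewrite !mem_enum !inW mK andbC.
(* A nonempty excursion returning to [B] would be an ear enlarging [B], against maximality. *)
have noB x s y : x \in B -> path (arc m) x s -> indep m s ->
    apart m s (enum B) -> y \in B -> arc m (last x s) y -> s = [::].
  move=> xB ps is_ /apartP sB yB ly; case: s => // z s in ps is_ sB ly *.
  have zB : z \notin B by have [] := sB z (mem_head _ _); rewrite mem_enum.
  suff Q' : Q (B :|: [set t in z :: s]).
    have := maxsetsup maxB Q' (subsetUl _ _) => /setP /(_ z).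
    by rewrite !inE eqxx orbT (negPf zB).
  rewrite /Q inE vB /=; apply/andP; split.
    apply/forall_inP=> t; rewrite !(in_setU, in_set) negb_or => /orP[tB|ts].
      rewrite Bm //=; apply/negP=> /sB[_]; rewrite mK mem_enum tB //.
    by have [_] := sB t ts; rewrite mem_enum => ->; case/indepP: is_ => _ ->.
  have st' := strong_extend st xB yB ps ly.
  by apply/forall_inP=> a aB; apply/forall_inP=> b bB; apply: st'.
(* Reversed, an excursion from [W] to [W] is one from [B] to [B], hence empty. *)
have noW x s y z : x \in W -> path (arc m) x (rcons s y) -> indep m s ->
    apart m s (enum B) -> y \in W -> z \notin s.
  rewrite !inW rcons_path => xB /andP[ps ly] is_ sB yB.
  have : path (arc m) (m y) (rcons (mrev m s) (m x)).
    have /(path_mrev hm) : path (arc m) x (rcons s y) by rewrite rcons_path ps.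
    by rewrite /mrev rev_cons map_rcons.
  rewrite rcons_path => /andP[ps' ly'].
  have : mrev m s = [::].
    by apply: noB ly'; rewrite ?indep_mrev ?apart_mrevl.
  by move/(congr1 size); rewrite size_map size_rev => /size0nil ->.
have [x0 [p [y [x0B pp ip apB [lp yBp]]]]] := lollipop hm conn Bm vB.
have Wm : {in W, forall x, m x \notin W} by move=> x; rewrite !inW => /Bm.
have mvW : m v \in W by rewrite inW mK.
have [z0 [q [y' [z0W pq iq aqW [lq yWq]]]]] := lollipop hm conn Wm mvW.
have aqB : apart m q (enum B) by rewrite -apW.
have vBW : v \in B :|: W by rewrite inE vB.
have [m' [s [hm' sw' out [ss us sB [hs ls vs]]]]] :=
  route_through hm sw dBW st z0W x0B vBW.
have [mK' _] := hm'.
case: s => [|b l] in ss us sB hs ls vs.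
  by move: z0W; rewrite -[z0]/(last z0 [::]) ls inW => /Bm; rewrite mK x0B.
rewrite /= in ss hs ls.
(* The excursions avoid [B] and [W], the only places where [m'] may differ from [m], so what is
   known about them carries over to [m']. *)
have eqm t : apart m t (enum B) -> {in t, m' =1 m}.
  move/apartP=> h x /h []; rewrite !mem_enum -(inW x) => xB xW; exact: out.
have eqp a t : apart m t (enum B) -> path (arc m) a t -> path (arc m') a t.
  by move=> h; rewrite (eq_path_arc (m' := m')) // => x /(eqm _ h).
have cover P : (forall x, x \in b :: l -> x \in posy_vertices P /\ m' x \in posy_vertices P) ->
    v \in posy_vertices P.
  by move=> h; case/orP: vs => /h[]; rewrite ?mK'.
have eqi t : apart m t (enum B) -> indep m' t = indep m t.
  by move=> h; apply: eq_indep; apply: eqm.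
have eqa t t' : apart m t (enum B) -> apart m' t t' = apart m t t'.
  by move=> h; apply: eq_in_all => x /(eqm _ h)->.
exists m'; split=> //.
have apl t : apart m t (enum B) -> apart m' (b :: l) t.
  move=> h; rewrite apart_sym //; apply: (apart_sub (s1' := t) (s2' := enum B)) => //.
    by move=> x /sB; rewrite mem_enum.
  by rewrite eqa.
have st' : strong m' B := strong_indep hm hm' sw sw' st.
have psp t : path (arc m) x0 t -> apart m t (enum B) -> path (arc m') b (l ++ t).
  by move=> pt /eqp h; rewrite cat_path ss /= ls h.
have pz t : path (arc m) z0 t -> apart m t (enum B) -> path (arc m') (m' b) t.
  by rewrite hs => pt /eqp h; apply: h.
have [apq|napq] := boolP (apart m p q).
  have [|||||||P [TP /cover h]] := @tposy_closing m' B W b l p y q y'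
    hm' sw' dBW st' us sB (psp _ pp apB) _ yBp (pz _ pq aqB) _ yWq.
  - by rewrite last_cat ls.
  - by rewrite hs.
  - by rewrite eqi.
  - by rewrite eqi.
  - by rewrite eqa.
  - by rewrite eqa.
  - by rewrite eqa.
  by exists P.
(* [h] is the first vertex of the second excursion that lies on the first one or has its mate
   there. *)
have [q1 [h [q2 [eq1 aq1 naq]]]] : exists q1 h q2,
    [/\ q = q1 ++ h :: q2, apart m q1 p & ~~ apart m (rcons q1 h) p].
  by apply: (@last_good_prefix _ (fun t => apart m t p)); rewrite // apart_sym.
have pq1 : path (arc m) z0 (rcons q1 h).
  by move: pq; rewrite eq1 -cat_rcons cat_path => /andP[].
have iq1 : indep m q1 by move: iq; rewrite eq1 indep_cat // => /and3P[].
have aq1B : apart m q1 (enum B) by move: aqB; rewrite eq1 apart_catl => /andP[].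
have mx0W : m x0 \in W by rewrite inW mK.
have {naq} : (h \in p) || (m h \in p).
  apply: contraNT naq; rewrite negb_or => /andP[h1 h2].
  by rewrite -cats1 apart_catl aq1 /apart /= h1 h2.
have back t p1 : path (arc m) x0 (rcons p1 t) ->
    path (arc m) (m t) (rcons (mrev m p1) (m x0)).
  by move/(path_mrev hm); rewrite /mrev rev_cons map_rcons.
(* If [m h] were on [p], following [q] to [h] and then [p] backwards to [m x0] would be an excursion
   from [W] to [W]. *)
have [hp _|hp /= mhp] := boolP (h \in p); last first.
  case/splitPr: mhp pp ip apB aq1 {lp yBp hp napq} => p1 p2.
  rewrite -cat_rcons => pp ip apB aq1.
  move: (pp); rewrite cat_path => /andP[/back + _]; rewrite mK => pback.
  have e : mrev m (rcons p1 (m h)) = h :: mrev m p1 by rewrite /mrev rev_rcons /= mK.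
  have /negP[] : h \notin q1 ++ mrev m (rcons p1 (m h)); last first.
    by rewrite e mem_cat mem_head orbT.
  move: aq1 ip apB; rewrite apart_catr // indep_cat // apart_catl.
  case/andP=> aq1 _ /and3P[ip1 _ _] /andP[ap1B _].
  apply: (noW z0 _ (m x0)) => //.
  - by rewrite e rcons_cat -cat_rcons cat_path pq1 last_rcons.
  - by rewrite indep_cat // iq1 indep_mrev // ip1 apart_mrevr.
  - by rewrite apart_catl aq1B apart_mrevl.
case/splitPr: hp pp ip apB lp yBp aq1 {napq} => p1 p2 pp ip apB lp yBp aq1.
have ph2 : path (arc m) z0 (q1 ++ h :: p2).
  by rewrite -cat_rcons cat_path pq1 last_rcons; move: pp; rewrite cat_path => /and3P[].
have [ip1 ihp2 ap12] : [/\ indep m p1, indep m (h :: p2) & apart m p1 (h :: p2)].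
  by apply/and3P; rewrite -indep_cat.
have [aq1p1 aq1p2] : apart m q1 p1 /\ apart m q1 (h :: p2).
  by apply/andP; rewrite -apart_catr.
have [ap1B ap2B] : apart m p1 (enum B) /\ apart m (h :: p2) (enum B).
  by apply/andP; rewrite -apart_catl.
have hq : h \in q1 ++ h :: p2 by rewrite mem_cat mem_head orbT.
(* The first excursion must close after [h]. Otherwise [q1] followed by [h :: p2] returns to [W],
   directly at [m y] if y is in [B], and backwards along the start of [p] to [m x0] if y is on
   [p1]. *)
have {yBp} : y \in h :: p2.
  apply: contraT => yn.
  move: yBp; rewrite mem_cat (negPf yn) orbF => /orP[yB|yp].
    suff: h \notin q1 ++ h :: p2 by rewrite hq.
    apply: (noW z0 _ (m y)) => //.
    - by rewrite rcons_path ph2 last_cat /= /arc mK; rewrite last_cat in lp.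
    - by rewrite indep_cat // iq1 ihp2.
    - by rewrite apart_catl aq1B ap2B.
    - by rewrite inW mK.
  case/splitPr: yp pp ip1 ap12 aq1p1 ap1B lp {ip apB aq1} => p3 p4.
  rewrite -(cat_rcons y) => pp ip1 ap12 aq1p1 ap1B lp.
  suff: h \notin (q1 ++ h :: p2) ++ mrev m (rcons p3 y) by rewrite mem_cat hq.
  move: ip1 ap12 aq1p1 ap1B.
  rewrite indep_cat // !apart_catl apart_catr // => /and3P[i3 _ _] /andP[a32 _].
  case/andP=> a3 _ /andP[a3B _].
  apply: (noW z0 _ (m x0)) => //.
  - rewrite rcons_cat cat_path ph2 /= /mrev rev_rcons /=.
    move: pp; rewrite -catA cat_path => /andP[/back -> _].
    by rewrite andbT last_cat /= /arc mK; rewrite last_cat in lp.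
  - rewrite !indep_cat // iq1 ihp2 aq1p2 indep_mrev // i3 apart_catl !apart_mrevr //.
    by rewrite a3 apart_sym.
  - by rewrite !apart_catl aq1B ap2B apart_mrevl.
move=> yp2.
have [s0 [c [e ly]]] : exists s0 c, p2 = s0 ++ c /\ last h s0 = y.
  move: yp2; rewrite inE => /predU1P[->|]; first by exists [::], p2.
  by case/splitPr=> l1 l2; exists (rcons l1 y), l2; rewrite cat_rcons last_rcons.
subst p2.
have il : indep m' (b :: l).
  apply/indepP; split=> // x /sB xB; have [BW _] := sw'.
  by apply: contraL (BW _ xB) => /sB xB'; rewrite (disjointFr dBW).
have [|||P [TP /cover H]] :=
  @tposy_crossing m' b l p1 h s0 c q1 hm' _ (psp _ pp apB) (pz _ pq1 _).
- have -> : p1 ++ (h :: s0) ++ c ++ q1 = (p1 ++ h :: s0 ++ c) ++ q1.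
    by rewrite -catA /= -catA.
  rewrite (indep_cat (b :: l)) // il indep_cat // eqi // ip eqi // iq1 eqa //.
  by rewrite (apart_sym _ q1) // aq1 apl // apart_catl apB aq1B.
- rewrite -cats1 apart_catl aq1B.
  by move: ap2B; rewrite -cat1s apart_catl => /andP[].
- by move: lp; rewrite last_cat /= last_cat ly.
by exists P.
Qed.

(** * From Jposies to strong connectivity *)

Lemma edgesP (e : {set G}) :
  reflect (exists u v, e = [set u; v] /\ adj u v) (e \in edges G).
Proof.
apply: (iffP imset2P) => [[u v _]|[u [v [-> uv]]]].
  by rewrite inE => /andP[_ uv] ->; exists u, v.
by exists u v; rewrite ?inE.
Qed.

Lemma card_cover_matching M : matching M -> #|cover M| = #|M| * 2.
Proof.
case/andP=> /subsetP sub /eqP <-; rewrite -sum_nat_const.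
apply: eq_bigr => e /sub/edgesP[u [v [-> uv]]]; rewrite cards2.
by case: eqP uv => // ->; rewrite adj_irrefl.
Qed.

Lemma pair_edges_mem m x (e : {set G}) : involutive m ->
  e \in pair_edges m -> x \in e -> e = [set x; m x].
Proof.
by move=> mK /imsetP[y _ ->] /set2P[]->; rewrite ?mK // setUC.
Qed.

Lemma pair_edges_matching m : pairing m -> matching (pair_edges m).
Proof.
move=> [mK ma]; apply/andP; split.
  by apply/subsetP=> _ /imsetP[x _ ->]; apply/edgesP; exists x, (m x).
apply/trivIsetP=> e f eM fM; apply: contraR => /pred0Pn[x /= /andP[xe xf]].
by rewrite (pair_edges_mem mK eM xe) (pair_edges_mem mK fM xf).
Qed.

(** A matching covers twice as many vertices as it has edges, and this one covers all vertices. *)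
Lemma pair_edges_maximum m : pairing m -> maximum_matching (pair_edges m).
Proof.
move=> hm; have mM := pair_edges_matching hm; rewrite /maximum_matching mM.
apply/forall_inP=> N mN; rewrite -(leq_pmul2r (isT : 0 < 2)).
rewrite -!card_cover_matching //; apply: subset_leq_card.
apply/subsetP=> x _; apply/bigcupP; exists [set x; m x]; last exact: set21.
exact: imset_f.
Qed.

Lemma perfect_matching_pairing M : perfect_matching M ->
  exists m, pairing m /\ M = pair_edges m.
Proof.
case/andP=> /andP[/subsetP sub tri] /eqP cov.
(* The default value [x] never occurs, because the matching is perfect. *)
pose m x := odflt x [pick y | [set x; y] \in M].
have mM x : [set x; m x] \in M.
  rewrite /m; case: pickP => //= none.
  have /bigcupP[e eM xe] : x \in cover M by rewrite cov inE.
  have /edgesP[u [v [ee _]]] := sub e eM.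
  by move: xe; rewrite ee => /set2P[]xe; [have := none v | have := none u];
    rewrite xe -?ee ?eM // setUC -ee eM.
have adjM x y : [set x; y] \in M -> adj x y.
  move=> /sub/edgesP[u [v [e uv]]].
  have /set2P[ex|ex] : x \in [set u; v] by rewrite -e set21.
    have : v \in [set x; y] by rewrite e set22.
    by case/set2P=> vE; move: uv; rewrite ?vE ex ?adj_irrefl.
  have : u \in [set x; y] by rewrite e set21.
  by case/set2P=> uE; move: uv; rewrite ?uE ex ?adj_irrefl // adj_sym.
have uniqM x y z : [set x; y] \in M -> [set x; z] \in M -> y = z.
  move=> xy xz; have e : [set x; y] = [set x; z].
    apply/eqP; apply: contraTT isT => ne.
    have /pred0P/(_ x) := trivIsetP tri _ _ xy xz ne.
    by rewrite /= !set21.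
  have : y \in [set x; z] by rewrite -e set22.
  by case/set2P=> // yx; have := adjM _ _ xy; rewrite yx adj_irrefl.
have mK : involutive m by move=> x; apply: (uniqM (m x)); rewrite // setUC.
exists m; split; first by split=> // x; apply: adjM.
apply/setP=> e; apply/idP/imsetP => [eM|[x _ ->]//].
have /edgesP[u [v [ee _]]] := sub e eM; exists u => //.
by rewrite ee; congr [set _; _]; apply: (uniqM u); rewrite -?ee.
Qed.

Lemma connect_skew m x y : pairing m ->
  connect (arc m) x y -> connect (arc m) (m y) (m x).
Proof.
move=> hm /connectP[p pp ->]; apply/connectP.
exists (mrev m (belast x p)); last by rewrite last_skew.
exact: path_skew.
Qed.

(* The k matching edges of a blossom cover 2k of its 2k+1 vertices, hence all but
   the base, which forces them to alternate along the rest of the cycle. *)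
Lemma blossom_zig m c b : pairing m -> blossom (pair_edges m) c ->
  blossom_base (pair_edges m) c b ->
  exists d, [/\ c =i b :: zig m d, path (arc m) b d & adj (last b d) b].
Proof.
move=> hm [/and3P[_ uc cc] [k [sk Ek]]] /andP[bc /forall_inP base].
have [mK _] := hm.
have {}base u : u \in c -> m b <> u.
  move=> uc' mbu; have := base u uc'; rewrite in_pair_edges // mbu eqxx implybF.
  by rewrite negbK => /eqP ub; have := pairing_neq b hm; rewrite mbu ub eqxx.
pose E := cycle_edges c :&: pair_edges m.
have EP e : e \in E -> exists u, [/\ u \in c, next c u = m u & e = [set u; m u]].
  case/setIP=> /imsetP[u uc' ->]; rewrite in_pair_edges // => /eqP nu.
  by exists u; rewrite -nu.
have mE : matching E.
  have /andP[sub tri] := pair_edges_matching hm.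
  rewrite /matching (subset_trans _ sub) ?subsetIr //.
  by apply: trivIsetS tri; apply: subsetIr.
(* The inclusion holds because [b] is not matched inside the cycle; both sides have 2k elements. *)
have cE : cover E = [set x in c] :\ b.
  apply/eqP; rewrite eqEcard card_cover_matching // Ek; apply/andP; split.
    apply/bigcupsP=> e /EP[u [uc' nu ->]]; apply/subsetP=> x.
    rewrite !inE => /pred2P[]->; rewrite -?nu ?mem_next uc' andbT.
      by apply/eqP=> ub; apply: (base (next c u)); rewrite ?mem_next // nu ub.
    by rewrite nu; apply/eqP=> mub; apply: (base u); rewrite // -mub mK.
  have := cardsD1 b [set x in c]; rewrite inE bc cardsE (card_uniqP uc) sk.
  by rewrite addnC => /addnI <-; rewrite mulnC.
have nextE x : x \in c -> x != b -> next c x = m x \/ next c (m x) = x.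
  move=> xc xb; have : x \in cover E by rewrite cE !inE xb.
  case/bigcupP=> e /EP[u [uc' nu ->]] /set2P[]->; first by left.
  by right; rewrite mK.
case/rot_to: bc => i c' rc.
have mc : b :: c' =i c by move=> x; rewrite -rc mem_rot.
have nc : next (b :: c') =1 next c by move=> x; rewrite -rc next_rot.
have urc : uniq (b :: c') by rewrite -rc rot_uniq.
have crc : cycle (@adj G) (b :: c') by rewrite -rc rot_cycle.
have nl : next c (last b c') = b.
  by have := cycle_next urc; rewrite /= rcons_path -nc => /andP[_ /eqP].
(* Walking around from the base: when [x] is the base or is matched to an earlier vertex, the vertex
   after [x] cannot be matched backwards, so its mate follows it. Here [n] only bounds the
   length. *)
have zigE n l s x : size l < n -> b :: c' = s ++ x :: l ->
    (x == b) || (m x \in s) -> exists d, l = zig m d.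
  elim: n l s x => // n IH [|y l] s x; first by exists [::].
  rewrite ltnS /= => sl e xs.
  have yc : y \in c by rewrite -mc e mem_cat !inE eqxx !orbT.
  have := urc; rewrite e -cat_rcons cat_uniq => /and3P[_ /hasPn dis _].
  have ys : y \notin rcons s x by apply: dis; rewrite mem_head.
  have bs : b \in rcons s x.
    case: (s) e => [[->]|a s' [-> _]]; first by rewrite mem_rcons mem_head.
    by rewrite mem_rcons !inE eqxx orbT.
  have yb : y != b by apply: contraNneq ys => ->.
  have [ny|ny] := nextE y yc yb; last first.
    have xy : m y = x.
      apply: (can_inj (prev_next urc)); rewrite !nc ny -nc e next_cat_cons //.
      by rewrite -e.
    case/orP: xs => [/eqP xb|]; first by case: (base y yc); rewrite -xb -xy mK.
    by rewrite -xy mK => ys'; rewrite mem_rcons inE ys' orbT in ys.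
  (* If that vertex were the last one, its successor would be the base, and the base would be
     matched inside the cycle. *)
  case: l sl e dis => [|z l] sl e dis.
    have : last b c' = y by rewrite -[last b c']/(last b (b :: c')) e last_cat.
    move=> ly; case: (base y yc); rewrite -nl ly ny mK //.
  have zy : z = m y.
    rewrite -ny -nc e -cat_rcons next_cat_cons // cat_rcons -e //.
  have [||d ->] := IH l (rcons (rcons s x) y) z (ltnW sl).
  - by rewrite e -!cats1 -!catA.
  - by rewrite zy mK mem_rcons mem_head orbT.
  by exists (z :: d); rewrite -[y]mK -zy.
have [|d ed] := zigE _ c' [::] b (ltnSn _) erefl; first by rewrite eqxx.
exists d; split; first by move=> x; rewrite -mc ed.
  by move: crc; rewrite /= rcons_path ed path_zig // => /andP[].
by move: crc; rewrite /= rcons_path ed last_zig => /andP[].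
Qed.

(** The last vertex of the walk around the blossom is adjacent to [b], so it has an arc to [m b].
    Half of the vertices are passed on this trip, and their mates on the reversed one. *)
Lemma blossom_connect m c b : pairing m -> blossom (pair_edges m) c ->
  blossom_base (pair_edges m) c b ->
  forall x, x \in c -> connect (arc m) b x /\ connect (arc m) x (m b).
Proof.
move=> hm bl base x; have [d [-> pd ld]] := blossom_zig hm bl base.
have [mK _] := hm.
have pd' : path (arc m) b (rcons d (m b)) by rewrite rcons_path pd /arc mK.
have dP y : y \in b :: d -> connect (arc m) b y /\ connect (arc m) y (m b).
  rewrite inE => /predU1P[->|yd].
    by split=> //; apply/connectP; exists (rcons d (m b)); rewrite ?last_rcons.
  case/splitPr: yd pd' => d1 d2; rewrite -cat_rcons rcons_cat cat_path last_rcons.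
  case/andP=> p1 p2; split; apply/connectP.
    by exists (rcons d1 y); rewrite ?last_rcons.
  by exists (rcons d2 (m b)); rewrite ?last_rcons.
rewrite in_cons mem_zig // => /or3P[/eqP->|xd|/(mem_behead (s := b :: d))/dP[h1 h2]].
- by apply: dP; rewrite mem_head.
- by apply: dP; rewrite inE xd orbT.
by have := connect_skew hm h1; have := connect_skew hm h2; rewrite !mK.
Qed.

(** After the matching edge [f], an even number of edges group into pairs of a nonmatching edge
    followed by a matching one. *)
Lemma alternating_zig m a l (f : {set G}) : pairing m -> f \in pair_edges m ->
  path (fun f g : {set G} => (f \in pair_edges m) (+) (g \in pair_edges m)) f
    (walk_edges a l) -> ~~ odd (size l) -> exists d, l = zig m d.
Proof.
move=> [mK _]; have [n] := ubnP (size l).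
elim: n l a f => // n IH [|y [|z l]] a f //; first by exists [::].
rewrite ltnS => sl fM /= /and3P[]; rewrite fM /= => ay; rewrite (negPf ay) /= => yz.
rewrite negbK => pl ol; have [d ->] := IH l z _ (ltnW sl) yz pl ol.
by exists (z :: d); move: yz; rewrite in_pair_edges // => /eqP->; rewrite /zig /= mK.
Qed.

(** The base [b1] is a hub: a closed walk goes around the first blossom to [m b1], along the walk to
    [b2], around the second blossom to [m b2] and back along the reversed walk to [b1]. Every vertex
    is reached from [b1] and leads back to it. *)
Lemma Jposy_connect m P : pairing m -> Jposy (pair_edges m) P ->
  posy_vertices P = [set: G] -> forall x y, connect (arc m) x y.
Proof.
move=> hm; have [mK _] := hm.
case: P => c1 c2 b1 p; rewrite /Jposy /= => -[[bl1 bl2] [wp op] alt ba1 ba2] cov.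
case: p => [//|a p] in wp op alt ba1 ba2 cov *.
move: alt; rewrite /mm_alternating /alternating /= => /and3P[pp e1 _].
have [d ed] := alternating_zig hm e1 pp op.
move: e1; rewrite in_pair_edges // => /eqP ea.
move: wp ba2 cov; rewrite /walk /= ed path_zig // last_zig => /andP[_ pd] ba2 cov.
set b2 := last a d in ba2.
have c12 : connect (arc m) (m b1) b2 by rewrite -ea; apply/connectP; exists d.
have c21 : connect (arc m) (m b2) b1.
  by have := connect_skew hm c12; rewrite mK.
have C1 := blossom_connect hm bl1 ba1; have C2 := blossom_connect hm bl2 ba2.
have [b1c _] := andP ba1; have [b2c _] := andP ba2.
have [_ c11] := C1 _ b1c; have [_ c22] := C2 _ b2c.
have t := connect_trans.
have b1b2 := t _ _ _ _ _ c11 c12; have mb1b1 := t _ _ _ _ _ c12 (t _ _ _ _ _ c22 c21).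
have dP x : x \in d -> connect (arc m) b1 x /\ connect (arc m) x b1.
  move=> xd; have [ax xb] : connect (arc m) a x /\ connect (arc m) x b2.
    rewrite /b2; case/splitPr: xd pd => d1 d2; rewrite -cat_rcons cat_path last_cat.
    rewrite last_rcons => /andP[p1 p2]; split; apply/connectP; last by exists d2.
    by exists (rcons d1 x); rewrite ?last_rcons.
  rewrite ea in ax; split; first exact: t c11 ax.
  exact: t xb (t _ _ _ _ _ c22 c21).
have hub x : connect (arc m) b1 x /\ connect (arc m) x b1.
  have : x \in [set: G] by [].
  rewrite -cov inE !in_cons mem_zig // => /or4P[/C1[h1 h2]|/C2[h1 h2]|/eqP->//|].
  - by split=> //; apply: t h2 mb1b1.
  - by split; [apply: t b1b2 h1 | apply: t h2 c21].
  case/or3P=> [/eqP->|/dP//|/dP[h1 h2]]; first by rewrite ea.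
  have := connect_skew hm h1; have := connect_skew hm h2; rewrite !mK => h3 h4.
  by split; [apply: t c11 h3 | apply: t h4 mb1b1].
by move=> x y; have [_ h] := hub x; have [h' _] := hub y; apply: t h h'.
Qed.
End Jposies.

Theorem theorem5p6 (G : sgraph) (hG : Jposy_graph G) (v : G) :
  exists M : {set {set G}}, maximum_matching M /\
    exists P : posy G, Tposy M P /\ v \in posy_vertices P.
Proof.
case: hG => M [/perfect_matching_pairing[m [hm ->]] [J [hJ cov _]]].
have [m' [hm' TP]] := tposy_of_connect v hm (Jposy_connect hm hJ cov).
by exists (pair_edges m'); split; first exact: pair_edges_maximum.
Qed.
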